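(* Let $(G,E,\varphi)$ be a self-similar triple and let $R$ be a unital commutative $*$-ring. For each $n\in\mathbb{Z}$ define $$A_n:=\operatorname{span}_R\{s_{\alpha,g}s_{\beta,e_G}^*:\alpha,\beta\in E^*,\ g\in G,\ s(\alpha)=g\cdot s(\beta),\ |\alpha|-|\beta|=n\}.$$ Then $(A_n)_{n\in\mathbb{Z}}$ is a $\mathbb{Z}$-grading on $L_R(G,E)$; that is, each $A_n$ is an $R$-submodule, $L_R(G,E)=\bigoplus_{n\in\mathbb{Z}}A_n$, and $A_mA_n\subseteq A_{m+n}$ for all $m,n\in\mathbb{Z}$.
   Context: A unital commutative $*$-ring $R$ is a commutative ring with $1$ together with an involution $r\mapsto r^*$. A $*$-algebra over $R$ is an (associative, not necessarily unital) $R$-algebra with a map $a\mapsto a^*$ satisfying $(a^* )^*=a$, $(ab)^*=b^*a^*$, $(ra+b)^*=r^*a^*+b^*$. A projection is $p=p^*=p^2$; a partial isometry is $s=ss^*s$. A directed graph $E=(E^0,E^1,r,s)$ has countable vertex set $E^0$, countable edge set $E^1$ and maps $r,s\colon E^1\to E^0$. It is row-finite if $vE^1:=r^{-1}(v)$ is finite for all $v$, and has no sources if $vE^1\neq\emptyset$ for all $v$. An action of a group $G$ on $E$ is a homomorphism from $G$ to the group of bijections of $E^0\sqcup E^1$ that preserve $E^0$ and $E^1$ and commute with $r$ and $s$. A self-similar triple $(G,E,\varphi)$: a countable discrete group $G$ (unit $e_G$), a row-finite graph $E$ with no sources, an action of $G$ on $E$, and a map $\varphi\colon G\times E^1\to G$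 with $\varphi(gh,e)=\varphi(g,h\cdot e)\varphi(h,e)$ and $\varphi(g,e)\cdot v=g\cdot v$ for all $g,h\in G$, $e\in E^1$, $v\in E^0$. An $E$-family in a $*$-algebra: mutually orthogonal projections $P_v$ ($v\in E^0$) and partial isometries $S_e$ ($e\in E^1$) with $S_e^*S_f=\delta_{e,f}P_{s(e)}$ and $P_v=\sum_{e\in vE^1}S_eS_e^*$. A $(G,E)$-family: elements $P_{v,f}$, $S_{e,g}$ ($v\in E^0$, $e\in E^1$, $f,g\in G$) such that (a) $\{P_{v,e_G}\}\cup\{S_{e,e_G}\}$ is an $E$-family; (b) $(P_{v,f})^*=P_{f^{-1}\cdot v,f^{-1}}$; (c) $P_{v,f}P_{w,h}=\delta_{v,f\cdot w}P_{v,fh}$; (d) $P_{v,f}S_{e,g}=\delta_{v,r(f\cdot e)}S_{f\cdot e,\varphi(f,e)g}$; (e) $S_{e,g}P_{v,f}=\delta_{g\cdot v,s(e)}S_{e,gf}$. $L_R(G,E)$ is the universal $*$-algebra over $R$ generated by a $(G,E)$-family $\{p_{v,f},s_{e,g}\}$. Paths: $E^n$ ($n\ge1$) is the set of $\alpha=\alpha_1\cdots\alpha_n$ with $\alpha_i\in E^1$, $s(\alpha_i)=r(\alpha_{i+1})$, $r(\alpha)=r(\alpha_1)$, $s(\alpha)=s(\alpha_n)$, $|\alpha|=n$; vertices are paths of length $0$ with $r(v)=s(v)=v$; $E^*=\bigcup_{n\ge0}E^n$. For $g\in G$ put $s_{\alpha,g}:=s_{\alpha_1,e_G}\cdots s_{\alpha_{n-1},e_G}s_{\alpha_n,g}$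 if $n=|\alpha|>0$ and $s_{\alpha,g}:=p_{\alpha,g}$ if $\alpha\in E^0$. *)

(* Defs.v *)
From HB Require Import structures.
From mathcomp Require Import all_boot all_order all_algebra.
From mathcomp Require Import all_classical.

Set Implicit Arguments.
Unset Strict Implicit.
Unset Printing Implicit Defensive.

Import GRing.Theory.
Local Open Scope classical_set_scope.
Local Open Scope ring_scope.

(* The ring may be trivial, hence [ComPzRing].  By commutativity the
   involution is multiplicative as well as anti-multiplicative; it fixes 1
   because it is onto. *)
HB.mixin Record ComPzRing_isStarRing R of GRing.ComPzRing R := {
  rstar : R -> R;
  rstarK : involutive rstar;
  rstarD : {morph rstar : x y / x + y};
  rstarM : {morph rstar : x y / x * y}
}.

#[short(type="comStarRingType")]
HB.structure Definition ComStarRing :=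
  {R of GRing.ComPzRing R & ComPzRing_isStarRing R}.

(* The library's algebras are unital, so the product is added by hand on top
   of a module. *)
HB.mixin Record Lmodule_isStarAlgebra (R : comStarRingType) A
    of GRing.Lmodule R A := {
  amul : A -> A -> A;
  astar : A -> A;
  amulA : associative amul;
  amulDl : left_distributive amul +%R;
  amulDr : right_distributive amul +%R;
  amulZl : forall (c : R) (a b : A), amul (c *: a) b = c *: amul a b;
  amulZr : forall (c : R) (a b : A), amul a (c *: b) = c *: amul a b;
  astarK : involutive astar;
  astarM : forall a b : A, astar (amul a b) = amul (astar b) (astar a);
  astarP : forall (c : R) (a b : A),
    astar (c *: a + b) = rstar c *: astar a + astar b
}.

#[short(type="starAlgType")]
HB.structure Definition StarAlgebra (R : comStarRingType) :=
  {A of GRing.Lmodule R A & Lmodule_isStarAlgebra R A}.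

Declare Scope staralg_scope.
Delimit Scope staralg_scope with SA.
Notation "a ** b" := (amul a b)
  (at level 40, left associativity) : staralg_scope.
Notation "a ^*" := (astar a) : staralg_scope.
Local Open Scope staralg_scope.

Record star_hom (R : comStarRingType) (A B : starAlgType R)
    (h : A -> B) : Prop := StarHom {
  star_homP : forall (c : R) (a b : A), h (c *: a + b) = c *: h a + h b;
  star_homM : forall a b : A, h (a ** b) = h a ** h b;
  star_homS : forall a : A, h (a ^*) = (h a) ^*
}.

Definition is_projection (R : comStarRingType) (A : starAlgType R)
  (p : A) : Prop := p = p ^* /\ p = p ** p.

Definition is_partial_isometry (R : comStarRingType) (A : starAlgType R)
  (s : A) : Prop := s = s ** s ^* ** s.

Record digraph := Digraph {
  vertex : countType;
  edge : countType;
  grange : edge -> vertex;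
  gsource : edge -> vertex
}.
Arguments grange {d}.
Arguments gsource {d}.

Definition edges_into (E : digraph) (v : vertex E) : set (edge E) :=
  [set e | grange e = v].

Definition row_finite (E : digraph) : Prop :=
  forall v : vertex E, finite_set (edges_into v).

Definition no_sources (E : digraph) : Prop :=
  forall v : vertex E, edges_into v !=set0.

(* A homomorphism into the bijections of the disjoint union of vertices and
   edges that preserve both parts is a pair of actions; bijectivity follows
   from the action laws. *)
Record graph_action (G : groupType) (E : digraph) := GraphAction {
  vact : G -> vertex E -> vertex E;
  eact : G -> edge E -> edge E;
  vact1 : forall v, vact 1%g v = v;
  vactM : forall g h v, vact (g * h)%g v = vact g (vact h v);
  eact1 : forall e, eact 1%g e = e;
  eactM : forall g h e, eact (g * h)%g e = eact g (eact h e);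
  grange_act : forall g e, grange (eact g e) = vact g (grange e);
  gsource_act : forall g e, gsource (eact g e) = vact g (gsource e)
}.

Record self_similar_triple := SelfSimilarTriple {
  sst_group : groupType;
  sst_group_countable : countable [set: sst_group];
  sst_graph : digraph;
  sst_row_finite : row_finite sst_graph;
  sst_no_sources : no_sources sst_graph;
  sst_action : graph_action sst_group sst_graph;
  cocycle : sst_group -> edge sst_graph -> sst_group;
  cocycleM : forall g h e,
    cocycle (g * h)%g e = (cocycle g (eact sst_action h e) * cocycle h e)%g;
  cocycle_vact : forall g e v,
    vact sst_action (cocycle g e) v = vact sst_action g v
}.

Notation "''G_' T" := (sst_group T) (at level 8, T at level 2, format "''G_' T").
Notation "''V_' T" := (vertex (sst_graph T))
  (at level 8, T at level 2, format "''V_' T").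
Notation "''E_' T" := (edge (sst_graph T))
  (at level 8, T at level 2, format "''E_' T").
Notation "g ·v v" := (vact (sst_action _) g v) (at level 35, right associativity).
Notation "g ·e e" := (eact (sst_action _) g e) (at level 35, right associativity).

(* Since the graph is row-finite, the finitely supported sum below is the sum
   over all edges with range [v]. *)
Record is_E_family (R : comStarRingType) (A : starAlgType R) (E : digraph)
    (P : vertex E -> A) (S : edge E -> A) : Prop := IsEFamily {
  ef_proj : forall v, is_projection (P v);
  ef_orth : forall v w, v <> w -> P v ** P w = 0;
  ef_isom : forall e, is_partial_isometry (S e);
  ef_source : forall e f,
    (S e) ^* ** S f = if e == f then P (gsource e) else 0;
  ef_range : forall v, P v = \sum_(e \in edges_into v) (S e ** (S e) ^*)
}.

Record is_GE_family (T : self_similar_triple) (R : comStarRingType)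
    (A : starAlgType R) (P : 'V_T -> 'G_T -> A) (S : 'E_T -> 'G_T -> A)
    : Prop := IsGEFamily {
  gef_E : is_E_family (fun v => P v 1%g) (fun e => S e 1%g);
  gef_star : forall v f, (P v f) ^* = P ((f^-1)%g ·v v) (f^-1)%g;
  gef_PP : forall v w f h,
    P v f ** P w h = if v == (f ·v w) then P v (f * h)%g else 0;
  gef_PS : forall v e f g,
    P v f ** S e g =
      if v == grange (f ·e e) then S (f ·e e) (cocycle f e * g)%g else 0;
  gef_SP : forall v e f g,
    S e g ** P v f = if (g ·v v) == gsource e then S e (g * f)%g else 0
}.

(* [L], together with the family [p], [s], is L_R(G,E).  Uniqueness of [h]
   forces [L] to be generated by the family, as a star-algebra over [R]. *)
Definition is_universal_GE (T : self_similar_triple) (R : comStarRingType)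
    (L : starAlgType R) (p : 'V_T -> 'G_T -> L) (s : 'E_T -> 'G_T -> L)
    : Prop :=
  is_GE_family p s /\
  forall (B : starAlgType R) (P : 'V_T -> 'G_T -> B) (S : 'E_T -> 'G_T -> B),
    is_GE_family P S ->
    exists! h : L -> B,
      [/\ star_hom h,
          forall v f, h (p v f) = P v f
        & forall e g, h (s e g) = S e g].

(* [PathV v] is a path of length 0 and [PathE e es] the nonempty list of edges
   [e :: es], subject to [is_path]. *)
Inductive prepath (E : digraph) :=
| PathV of vertex E
| PathE of edge E & seq (edge E).
Arguments PathV {E}.
Arguments PathE {E}.

Definition is_path (E : digraph) (a : prepath E) : bool :=
  match a with
  | PathV _ => true
  | PathE e es => path (fun x y => gsource x == grange y) e es
  end.

Definition psource (E : digraph) (a : prepath E) : vertex E :=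
  match a with
  | PathV v => v
  | PathE e es => gsource (last e es)
  end.

Definition plength (E : digraph) (a : prepath E) : nat :=
  match a with
  | PathV _ => 0%N
  | PathE _ es => (size es).+1
  end.

Fixpoint edges_elt (T : self_similar_triple) (R : comStarRingType)
    (A : starAlgType R) (s : 'E_T -> 'G_T -> A) (e : 'E_T) (es : seq 'E_T)
    (g : 'G_T) : A :=
  match es with
  | [::] => s e g
  | f :: es' => s e 1%g ** edges_elt s f es' g
  end.

Definition path_elt (T : self_similar_triple) (R : comStarRingType)
    (A : starAlgType R) (p : 'V_T -> 'G_T -> A) (s : 'E_T -> 'G_T -> A)
    (a : prepath (sst_graph T)) (g : 'G_T) : A :=
  match a with
  | PathV v => p v g
  | PathE e es => edges_elt s e es g
  end.

Definition lspan (R : pzRingType) (V : lmodType R) (X : set V) : set V :=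
  [set x | exists (k : nat) (c : 'I_k -> R) (y : 'I_k -> V),
     (forall i, X (y i)) /\ x = \sum_(i < k) c i *: y i].

Definition is_submodule (R : pzRingType) (V : lmodType R) (W : set V) : Prop :=
  W 0 /\ forall (c : R) (x y : V), W x -> W y -> W (c *: x + y).

(* Internal direct sum: every element is, in exactly one way, the sum of a
   finitely supported family of elements of the given submodules. *)
Definition is_direct_sum (I : choiceType) (R : pzRingType) (V : lmodType R)
    (W : I -> set V) : Prop :=
  forall x : V, exists! f : I -> V,
    [/\ forall i, W i (f i),
        finite_set [set i | f i <> 0]
      & x = \sum_(i \in [set: I]) f i].

Definition is_Z_grading (R : comStarRingType) (A : starAlgType R)
    (W : int -> set A) : Prop :=
  [/\ forall n, is_submodule (W n),
      is_direct_sum W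
    & forall m n a b, W m a -> W n b -> W (m + n) (a ** b)].

Definition graded_part (T : self_similar_triple) (R : comStarRingType)
    (A : starAlgType R) (p : 'V_T -> 'G_T -> A) (s : 'E_T -> 'G_T -> A)
    (n : int) : set A :=
  lspan [set x | exists (a b : prepath (sst_graph T)) (g : 'G_T),
    [/\ is_path a, is_path b,
        psource a = g ·v psource b,
        (plength a)%:Z - (plength b)%:Z = n
      & x = path_elt p s a g ** (path_elt p s b 1%g) ^*]].

(* Main.v *)
Require Import Defs.
From HB Require Import structures.
From mathcomp Require Import all_boot all_order all_algebra.
From mathcomp Require Import finmap.
From mathcomp Require Import all_classical.

(* Left multiplication by a generator or by its adjoint shifts the degree of
   the spanning elements s_{a,g} s_b^* by 0, 1 or -1, so the parts A_n multiply
   as they should, and the external direct sum D of the A_n is again a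
   star-algebra.  The generators, placed in degrees 0 and 1, form a
   (G,E)-family in D, which gives h : L -> D.  Summing coefficients,
   ev : D -> L, is a homomorphism with ev h = id by uniqueness, so every x is
   the sum of the coefficients of h x; and h sends A_n to degree n, so no other
   decomposition is possible. *)

Set Implicit Arguments.
Unset Strict Implicit.
Unset Printing Implicit Defensive.

Import GRing.Theory.
Local Open Scope classical_set_scope.
Local Open Scope ring_scope.
Local Open Scope staralg_scope.

(** * Elementary algebra in star-algebras without unit and their homomorphisms *)

Section StarAlgebraTheory.
Variables (R : comStarRingType) (A : starAlgType R).
Implicit Types (a b c : A).

Lemma amul0l b : 0 ** b = 0 :> A.
Proof. by apply: (addrI (0 ** b)); rewrite -amulDl !addr0. Qed.

Lemma amul0r a : a ** 0 = 0 :> A.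
Proof. by apply: (addrI (a ** 0)); rewrite -amulDr !addr0. Qed.

Lemma amul_suml I (r : seq I) (F : I -> A) b :
  (\sum_(i <- r) F i) ** b = \sum_(i <- r) F i ** b.
Proof. by apply: (big_morph (fun a => a ** b)) => [x y|]; rewrite ?amulDl ?amul0l. Qed.

Lemma amul_sumr I (r : seq I) (F : I -> A) a :
  a ** (\sum_(i <- r) F i) = \sum_(i <- r) a ** F i.
Proof. by apply: (big_morph (amul a)) => [x y|]; rewrite ?amulDr ?amul0r. Qed.

Lemma astarD a b : (a + b)^* = astar a + astar b.
Proof.
(* Additivity is [astarP] with scalar 1, so it needs [rstar 1 = 1]; this follows by applying [rstar]
   to the product [1 * rstar 1]. *)
have r1 : rstar 1 = 1 :> R.
  by rewrite -[rstar 1]mulr1 -{2}(rstarK (1 : R)) -rstarM mul1r rstarK.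
by rewrite -{1}(scale1r a) astarP r1 scale1r.
Qed.

Lemma astar0 : 0^* = 0 :> A.
Proof. by apply: (addrI (astar 0)); rewrite -astarD !addr0. Qed.

Lemma astar_sum I (r : seq I) (F : I -> A) :
  (\sum_(i <- r) F i)^* = \sum_(i <- r) astar (F i).
Proof. by apply: (big_morph astar) => [x y|]; rewrite ?astarD ?astar0. Qed.

End StarAlgebraTheory.

Section StarHomTheory.
Variables (R : comStarRingType) (A B : starAlgType R) (h : A -> B).
Hypothesis hh : star_hom h.

Lemma star_homD a b : h (a + b) = h a + h b.
Proof. by rewrite -{1}(scale1r a) (star_homP hh) scale1r. Qed.

Lemma star_hom0 : h 0 = 0.
Proof. by apply: (addrI (h 0)); rewrite -star_homD !addr0. Qed.

Lemma star_hom_sum I (r : seq I) (F : I -> A) :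
  h (\sum_(i <- r) F i) = \sum_(i <- r) h (F i).
Proof. by apply: (big_morph h star_homD star_hom0). Qed.

Lemma star_hom_fsum (I : choiceType) (D : set I) (F : I -> A) : finite_set D ->
  h (\sum_(i \in D) F i) = \sum_(i \in D) h (F i).
Proof. by move=> fD; rewrite !fsbig_finite//= star_hom_sum. Qed.

End StarHomTheory.

Lemma star_hom_comp (R : comStarRingType) (A B C : starAlgType R)
    (h : A -> B) (k : B -> C) :
  star_hom h -> star_hom k -> star_hom (k \o h).
Proof.
case=> hP hM hS [kP kM kS]; split=> /= [c a b|a b|a].
- by rewrite hP kP.
- by rewrite hM kM.
- by rewrite hS kS.
Qed.

(** * Submodules stable under products and adjoints, and their external direct sum as a
    star-algebra *)

Lemma submodule_sum (R : pzRingType) (V : lmodType R) (W : set V) I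
    (r : seq I) (F : I -> V) :
  is_submodule W -> (forall i, W (F i)) -> W (\sum_(i <- r) F i).
Proof.
move=> [W0 WD] WF; elim/big_ind: _ => // x y Wx Wy.
by rewrite -(scale1r x); apply: WD.
Qed.

(** Independence of the parts is not included: for the [A_n] it is the very thing to be proved, so
    the direct sum is built from closure properties alone. *)
Record star_filtered (R : comStarRingType) (A : starAlgType R) (I : zmodType) :=
  StarFiltered {
    part :> I -> set A;
    part_submod : forall n, is_submodule (part n);
    part_mul : forall m n a b, part m a -> part n b -> part (m + n) (a ** b);
    part_star : forall n a, part n a -> part (- n) (a ^*)
  }.

(* The external direct sum of the parts, graded by construction; [dcoef x n]
   is the coefficient of the [n]-th power of the formal variable. *)
Record dsum (R : comStarRingType) (A : starAlgType R) (I : zmodType)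
    (W : star_filtered A I) := Dsum {
  dcoef :> I -> A;
  dcoef_fin : finite_set [set n | dcoef n <> 0];
  dcoef_part : forall n, W n (dcoef n)
}.

Section DirectSum.
Variables (R : comStarRingType) (A : starAlgType R) (I : zmodType).
Variable W : star_filtered A I.
Local Notation D := (dsum W).
Implicit Types (x y z : D) (S : {fset I}).

Lemma dsum_ext x y : (forall n, x n = y n) -> x = y.
Proof.
case: x y => [f f1 f2] [g g1 g2] /= fg.
have e : f = g by apply/funext.
by case: _ / e in g1 g2 fg *; congr Dsum; apply: Prop_irrelevance.
Qed.

Definition dsupp x : {fset I} := fset_set [set n | x n <> 0].

Lemma dsuppP x n : n \notin dsupp x -> x n = 0.
Proof.
rewrite in_fset_set; last exact: dcoef_fin.
by rewrite notin_setE /= => /contrapT.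
Qed.

Lemma finite_supp_in (f : I -> A) S :
  (forall n, n \notin S -> f n = 0) -> finite_set [set n | f n <> 0].
Proof. by move=> h; apply: (finite_subfset S) => n /=; apply: contra_notT => /h. Qed.

Lemma part0 n : W n 0. Proof. by case: (part_submod W n). Qed.
Lemma partP n k a b : W n a -> W n b -> W n (k *: a + b).
Proof. by case: (part_submod W n) => _; apply. Qed.

Definition dzero : D.
Proof.
apply: (@Dsum _ _ _ W (fun=> 0)); last exact: part0.
by apply: (@finite_supp_in _ fset0).
Defined.

(** Sum, opposite and scalar multiple are all instances of this one operation, so finite support and
    membership in the parts are checked only once. Ending with [Defined] lets the coefficients
    compute. *)
Definition dlin (k : R) x y : D.
Proof.
apply: (@Dsum _ _ _ W (fun n => k *: x n + y n)).
  apply: (@finite_supp_in _ (dsupp x `|` dsupp y)%fset) => n.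
  by rewrite inE negb_or => /andP[/dsuppP -> /dsuppP ->]; rewrite scaler0 addr0.
by move=> n; apply: partP; apply: dcoef_part.
Defined.

HB.instance Definition _ := gen_eqMixin D.
HB.instance Definition _ := gen_choiceMixin D.

Let dadd x y := dlin 1 x y.
Let dopp x := dlin (-1) x dzero.

Fact daddA : associative dadd.
Proof. by move=> x y z; apply: dsum_ext => n /=; rewrite !scale1r addrA. Qed.
Fact daddC : commutative dadd.
Proof. by move=> x y; apply: dsum_ext => n /=; rewrite !scale1r addrC. Qed.
Fact dadd0 : left_id dzero dadd.
Proof. by move=> x; apply: dsum_ext => n /=; rewrite scale1r add0r. Qed.
Fact daddN : left_inverse dzero dopp dadd.
Proof. by move=> x; apply: dsum_ext => n /=; rewrite scale1r scaleN1r addr0 addNr. Qed.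

HB.instance Definition _ := GRing.isZmodule.Build D daddA daddC dadd0 daddN.

Lemma dcoef0 n : (0 : D) n = 0. Proof. by []. Qed.
Lemma dcoefD x y n : (x + y) n = x n + y n.
Proof. by rewrite /= scale1r. Qed.
Lemma dcoef_sum J (r : seq J) (F : J -> D) n :
  (\sum_(i <- r) F i) n = \sum_(i <- r) F i n.
Proof. by apply: (big_morph (fun x : D => x n)) => [x y|]; rewrite ?dcoefD ?dcoef0. Qed.

Let dscale k x := dlin k x 0.
Fact dscaleA k l x : dscale k (dscale l x) = dscale (k * l) x.
Proof. by apply: dsum_ext => n /=; rewrite !addr0 scalerA. Qed.
Fact dscale1 : left_id 1 dscale.
Proof. by move=> x; apply: dsum_ext => n /=; rewrite addr0 scale1r. Qed.
Fact dscaleDr : right_distributive dscale +%R.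
Proof. by move=> k x y; apply: dsum_ext => n; rewrite /= !addr0 !scale1r scalerDr. Qed.
Fact dscaleDl x : {morph dscale^~ x : k l / k + l}.
Proof. by move=> k l; apply: dsum_ext => n; rewrite /= !addr0 scale1r scalerDl. Qed.

HB.instance Definition _ :=
  GRing.Zmodule_isLmodule.Build R D dscaleA dscale1 dscaleDr dscaleDl.

Lemma dcoefZ k x n : (k *: x) n = k *: x n.
Proof. by rewrite /= addr0. Qed.

(** Convolution of coefficients; the finite support of [x] makes the sum finite. *)
Definition dmulf x y n := \sum_(i \in [set: I]) x i ** y (n - i).

Lemma dmulfE x y S n : (forall i, i \notin S -> x i = 0) ->
  dmulf x y n = \sum_(i <- S) x i ** y (n - i).
Proof. by move=> xS; apply: fsbigTE => i /xS ->; rewrite amul0l. Qed.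

(** The Minkowski sum of the two supports. It contains the support of the product and serves as a
    common index set in the double sums below. *)
Definition dsumset x y : {fset I} :=
  [fset (i + j)%R | i in dsupp x, j in dsupp y]%fset.

Lemma dsumsetP x y i n :
  i \in dsupp x -> n \notin dsumset x y -> y (n - i) = 0.
Proof.
move=> xi; apply: contraNeq => yni; apply/imfset2P; exists i => //.
exists (n - i); last by rewrite addrC subrK.
by apply/negPn; apply: contraNN yni => /dsuppP ->.
Qed.

Lemma dmulf_supp x y n : n \notin dsumset x y -> dmulf x y n = 0.
Proof.
move=> nK; rewrite (dmulfE _ _ (@dsuppP x)) big_seq big1// => i ix.
by rewrite (dsumsetP ix nK) amul0r.
Qed.

Definition dmul x y : D.
Proof.
apply: (@Dsum _ _ _ W (dmulf x y)).
  exact: (finite_supp_in (@dmulf_supp x y)).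
move=> n; rewrite (dmulfE _ _ (@dsuppP x)).
apply: submodule_sum (part_submod W n) _ => i.
rewrite -{1}(subrK i n) addrC.
by apply: part_mul; apply: dcoef_part.
Defined.

Definition dstar x : D.
Proof.
apply: (@Dsum _ _ _ W (fun n => (x (- n))^*)).
  apply: (@finite_supp_in _ [fset - i | i in dsupp x]%fset) => n nS.
  rewrite dsuppP ?astar0//; apply: contraNN nS => nx.
  by apply/imfsetP; exists (- n); rewrite ?opprK.
by move=> n; rewrite -{1}(opprK n); apply: part_star; apply: dcoef_part.
Defined.

(** The substitution [k = i + j] gives an index set that does not depend on [i], so that the sums
    over [i] and [k] can be exchanged. *)
Lemma dmul_shift x y z n i : i \in dsupp x ->
  dmulf y z (n - i) = \sum_(k <- dsumset x y) y (k - i) ** z (n - k).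
Proof.
move=> ix; rewrite /dmulf (reindex_fsbigT (fun k => k - i)); last first.
  by exists (fun k => k + i) => k; rewrite ?subrK ?addrK.
rewrite (fsbigTE (dsumset x y)) => [|k kK]; last first.
  by rewrite (dsumsetP ix kK) amul0l.
by apply: eq_bigr => k _; rewrite opprB addrA subrK.
Qed.

(** Both sides are brought to the double sum of [x i ** y (k - i) ** z (n - k)] over [i] in the
    support of [x] and [k] in [dsumset x y]. *)
Fact dmulA : associative dmul.
Proof.
move=> x y z; apply: dsum_ext => n /=.
rewrite (dmulfE _ _ (@dsuppP x)) (@dmulfE (dmul x y) _ (dsumset x y)) /=; last first.
  exact: dmulf_supp.
under [RHS]eq_bigr do rewrite (dmulfE _ _ (@dsuppP x)) amul_suml.
rewrite exchange_big /= big_seq [RHS]big_seq; apply: eq_bigr => i ix.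
rewrite (dmul_shift _ _ _ ix) amul_sumr.
by apply: eq_bigr => k _; rewrite amulA.
Qed.

Fact dmulDl : left_distributive dmul +%R.
Proof.
move=> x y z; apply: dsum_ext => n; rewrite dcoefD.
pose S := (dsupp x `|` dsupp y)%fset.
have xS i : i \notin S -> x i = 0 by rewrite inE negb_or => /andP[/dsuppP].
have yS i : i \notin S -> y i = 0 by rewrite inE negb_or => /andP[_ /dsuppP].
rewrite [LHS](@dmulfE _ _ S) => [|i iS]; last by rewrite dcoefD xS ?yS ?addr0.
rewrite /= (dmulfE _ _ xS) (dmulfE _ _ yS) -big_split /=.
by apply: eq_bigr => i _; rewrite scale1r amulDl.
Qed.

Fact dmulDr : right_distributive dmul +%R.
Proof.
move=> x y z; apply: dsum_ext => n; rewrite dcoefD /=.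
rewrite !(dmulfE _ _ (@dsuppP x)) -big_split /=.
by apply: eq_bigr => i _; rewrite scale1r amulDr.
Qed.

Fact dmulZl k x y : dmul (k *: x) y = k *: dmul x y.
Proof.
apply: dsum_ext => n; rewrite dcoefZ /= (dmulfE _ _ (@dsuppP x)).
rewrite (@dmulfE _ _ (dsupp x)) => [|i /dsuppP xi]; last first.
  by rewrite dcoefZ xi scaler0.
by rewrite scaler_sumr; apply: eq_bigr => i _; rewrite dcoefZ amulZl.
Qed.

Fact dmulZr k x y : dmul x (k *: y) = k *: dmul x y.
Proof.
apply: dsum_ext => n; rewrite dcoefZ /= !(dmulfE _ _ (@dsuppP x)).
by rewrite scaler_sumr; apply: eq_bigr => i _; rewrite dcoefZ amulZr.
Qed.

Fact dstarK : involutive dstar.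
Proof. by move=> x; apply: dsum_ext => n /=; rewrite opprK astarK. Qed.

Fact dstarM x y : dstar (dmul x y) = dmul (dstar y) (dstar x).
Proof.
apply: dsum_ext => n /=; rewrite (dmulfE _ _ (@dsuppP x)) astar_sum.
(* In the product of the adjoints, index [k] carries the coefficient of [x] at [k - n]; after the
   shift by [n] both sums run over the support of [x]. *)
rewrite /dmulf (reindex_fsbigT (fun k => n + k)); last first.
  by exists (fun k => - n + k) => k /=; rewrite ?addKr ?addNKr.
rewrite (fsbigTE (dsupp x)) => [|i ix] /=; last first.
  by rewrite opprB addrAC subrr add0r (dsuppP ix) astar0 amul0r.
by apply: eq_bigr => i _; rewrite astarM opprB [n + i - n]addrAC subrr add0r opprD.
Qed.

Fact dstarP k x y : dstar (k *: x + y) = rstar k *: dstar x + dstar y.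
Proof. by apply: dsum_ext => n; rewrite dcoefD dcoefZ /= scale1r addr0 astarP. Qed.

HB.instance Definition _ := Lmodule_isStarAlgebra.Build R D
  dmulA dmulDl dmulDr dmulZl dmulZr dstarK dstarM dstarP.

Lemma dcoefM x y n : (x ** y) n = dmulf x y n. Proof. by []. Qed.

(** The formal variable is set to 1. *)
Definition deval x : A := \sum_(n \in [set: I]) x n.

Lemma devalE x S : (forall n, n \notin S -> x n = 0) ->
  deval x = \sum_(n <- S) x n.
Proof. exact: fsbigTE. Qed.

Lemma deval_hom : star_hom deval.
Proof.
split=> [k x y|x y|x].
- pose S := (dsupp x `|` dsupp y)%fset.
  have xS i : i \notin S -> x i = 0 by rewrite inE negb_or => /andP[/dsuppP].
  have yS i : i \notin S -> y i = 0 by rewrite inE negb_or => /andP[_ /dsuppP].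
  rewrite (devalE xS) (devalE yS) (@devalE _ S) => [|i iS]; last first.
    by rewrite dcoefD dcoefZ xS// yS// scaler0 addr0.
  rewrite scaler_sumr -big_split; apply: eq_bigr => i _.
  by rewrite dcoefD dcoefZ.
- rewrite (@devalE _ (dsumset x y)) => [|i iS]; last exact: dmulf_supp.
  under eq_bigr do rewrite dcoefM (dmulfE _ _ (@dsuppP x)).
  rewrite exchange_big /= (devalE (@dsuppP x)) amul_suml big_seq [RHS]big_seq.
  apply: eq_bigr => i ix; rewrite -amul_sumr; congr (_ ** _).
  (* For fixed [i], the shift by [i] turns the sum of all coefficients of [y] into the inner sum of
     the convolution. *)
  rewrite /deval (reindex_fsbigT (fun k => k - i)); last first.
    by exists (fun k => k + i) => k; rewrite ?subrK ?addrK.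
  by rewrite (fsbigTE (dsumset x y)) => // k; apply: dsumsetP.
- rewrite /deval (reindex_fsbigT -%R); last by exists -%R; exact: opprK.
  rewrite (fsbigTE (dsupp x)) => [|i ix] /=; last first.
    by rewrite opprK dsuppP ?astar0.
  rewrite (fsbigTE (dsupp x)) => [|i ix] /=; last exact: dsuppP.
  by rewrite astar_sum; apply: eq_bigr => i _ /=; rewrite opprK.
Qed.

Definition homogeneous n x := forall m, m != n -> x m = 0.

Lemma homogeneousP n k x y :
  homogeneous n x -> homogeneous n y -> homogeneous n (k *: x + y).
Proof.
by move=> hx hy m mn; rewrite dcoefD dcoefZ hx// hy// scaler0 addr0.
Qed.

Lemma homogeneous_sum n J (r : seq J) (F : J -> D) :
  (forall i, homogeneous n (F i)) -> homogeneous n (\sum_(i <- r) F i).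
Proof. by move=> hF m mn; rewrite dcoef_sum big1// => i _; apply: hF. Qed.

Lemma homogeneousM m n x y :
  homogeneous m x -> homogeneous n y -> homogeneous (m + n) (x ** y).
Proof.
move=> hx hy k kmn; rewrite dcoefM.
rewrite (@dmulfE _ _ [fset m]%fset) => [|i]; last by rewrite inE => /hx.
rewrite big_seq_fset1 hy ?amul0r//; apply: contraNneq kmn => <-.
by rewrite addrC subrK.
Qed.

Lemma homogeneous_star n x : homogeneous n x -> homogeneous (- n) (x ^*).
Proof. by move=> hx m mn; rewrite /= hx ?astar0// eqr_oppLR. Qed.

Lemma deval_homogeneous n x : homogeneous n x -> deval x = x n.
Proof.
move=> hx; rewrite (@devalE _ [fset n]%fset) ?big_seq_fset1// => i.
by rewrite inE => /hx.
Qed.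

(** A homogeneous element has a single coefficient, which evaluation returns. Hence an identity in
    [D] between elements of one degree can be checked in [A]. *)
Lemma homogeneous_inj n x y :
  homogeneous n x -> homogeneous n y -> deval x = deval y -> x = y.
Proof.
move=> hx hy; rewrite (deval_homogeneous hx) (deval_homogeneous hy) => xy.
by apply: dsum_ext => m; have [->//|mn] := eqVneq m n; rewrite hx// hy.
Qed.

Definition dmono n a (Wa : W n a) : D.
Proof.
apply: (@Dsum _ _ _ W (fun m => if m == n then a else 0)).
  by apply: (@finite_supp_in _ [fset n]%fset) => m; rewrite inE => /negPf ->.
by move=> m; case: eqP => [->//|_]; apply: part0.
Defined.

Lemma dmono_homogeneous n a (Wa : W n a) : homogeneous n (dmono Wa).
Proof. by move=> m /= /negPf ->. Qed.

Lemma deval_mono n a (Wa : W n a) : deval (dmono Wa) = a.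
Proof. by rewrite (deval_homogeneous (dmono_homogeneous Wa)) /= eqxx. Qed.

End DirectSum.

(** * Linear spans as least submodules *)

Section LinearSpan.
Variables (R : pzRingType) (V : lmodType R).

Lemma lspan_submod (X : set V) : is_submodule (lspan X).
Proof.
split; first by exists 0%N, (fun=> 0), (fun=> 0); split=> [[]//|]; rewrite big_ord0.
move=> c x y [m [cx [ux [Xx ->]]]] [n [cy [uy [Xy ->]]]].
exists (m + n)%N.
exists (fun i => match fintype.split i with inl i => c * cx i | inr i => cy i end).
exists (fun i => match fintype.split i with inl i => ux i | inr i => uy i end).
split=> [i|]; first by case: (fintype.split i).
rewrite big_split_ord /= scaler_sumr; congr (_ + _); apply: eq_bigr => i _.
  by rewrite -[lshift n i]/(unsplit (inl i)) unsplitK scalerA.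
by rewrite -[rshift m i]/(unsplit (inr i)) unsplitK.
Qed.

Lemma sub_lspan (X : set V) : X `<=` lspan X.
Proof.
by move=> x Xx; exists 1%N, (fun=> 1), (fun=> x); rewrite big_ord1 scale1r.
Qed.

Lemma submoduleZ (W : set V) c x : is_submodule W -> W x -> W (c *: x).
Proof. by move=> [W0 WD] Wx; rewrite -[_ *: _]addr0; apply: WD. Qed.

Lemma lspan_min (X W : set V) : is_submodule W -> X `<=` W -> lspan X `<=` W.
Proof.
move=> sW XW _ [n [c [u [Xu ->]]]]; apply: submodule_sum => // i.
by apply: submoduleZ => //; apply/XW/Xu.
Qed.

End LinearSpan.

(** * Paths, built by adding edges at the range end *)

Definition prange (E : digraph) (a : prepath E) : vertex E :=
  match a with
  | PathV v => v
  | PathE e es => grange e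
  end.

(** A path of length 0 loses its vertex here, so the source is preserved only when
    [gsource e = prange a]. *)
Definition pcons (E : digraph) (e : edge E) (a : prepath E) : prepath E :=
  match a with
  | PathV _ => PathE e [::]
  | PathE f es => PathE e (f :: es)
  end.

Section Paths.
Variable E : digraph.
Implicit Types (e : edge E) (a : prepath E).

Lemma is_path_pcons e a :
  is_path a -> gsource e = prange a -> is_path (pcons e a).
Proof. by case: a => [//|f es] /= h ->; rewrite eqxx. Qed.

Lemma psource_pcons e a : gsource e = prange a -> psource (pcons e a) = psource a.
Proof. by case: a. Qed.

Lemma plength_pcons e a : plength (pcons e a) = (plength a).+1.
Proof. by case: a. Qed.

Lemma prange_pcons e a : prange (pcons e a) = grange e.
Proof. by case: a. Qed.

(** Paths of length 0 and positive length are treated uniformly by peeling off the first edge, the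
    one that left multiplication meets. A single edge arises from the vertex at its source. *)
Lemma path_ind (Q : prepath E -> Prop) :
  (forall v, Q (PathV v)) ->
  (forall e a, is_path a -> gsource e = prange a -> Q a -> Q (pcons e a)) ->
  forall a, is_path a -> Q a.
Proof.
move=> QV QE [//|e es]; elim: es e => [|f es IH] e /= h.
  by apply: (QE e (PathV (gsource e))) => //; apply: QV.
case/andP: h => /eqP ef h.
by apply: (QE e (PathE f es)) => //; apply: IH.
Qed.

End Paths.

(** * The relations of a (G,E)-family, extended from edges to paths *)

Section Family.
Variables (T : self_similar_triple) (R : comStarRingType) (A : starAlgType R).
Variables (p : 'V_T -> 'G_T -> A) (s : 'E_T -> 'G_T -> A).
Hypothesis hps : is_GE_family p s.
Local Notation pe := (path_elt p s).
Local Notation path := (prepath (sst_graph T)).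
Implicit Types (v w : 'V_T) (e f : 'E_T) (g k : 'G_T) (a b : path) (x y : A).

Lemma vactV v g : g ·v ((g^-1)%g ·v v) = v.
Proof. by rewrite -vactM mulgV vact1. Qed.

Lemma s_split e g : s e g = s e 1%g ** p (gsource e) g.
Proof. by rewrite (gef_SP hps) vact1 eqxx mul1g. Qed.

Lemma star_s_s e f : (s e 1%g)^* ** s f 1%g = if e == f then p (gsource e) 1%g else 0.
Proof. exact: (ef_source (gef_E hps)). Qed.

Lemma path_elt_pcons e a g : is_path a ->
  s e 1%g ** pe a g = if gsource e == prange a then pe (pcons e a) g else 0.
Proof.
case: a => [v|f es] h /=; first by rewrite (gef_SP hps) vact1 eq_sym mul1g.
(* If the vertices do not match, a projection at [gsource e] is inserted between the two factors,
   and it annihilates the right one. *)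
case: eqP => // ne; rewrite s_split -amulA.
have -> : p (gsource e) 1%g ** edges_elt s f es g = 0; last by rewrite amul0r.
by case: es h => [|f' es] h /=; rewrite ?amulA (gef_PS hps) eact1;
  case: eqP => //; rewrite amul0l.
Qed.

Lemma path_elt_p a g v k : is_path a ->
  pe a g ** p v k = if g ·v v == psource a then pe a (g * k)%g else 0.
Proof.
move=> ha; elim/path_ind: a / ha => [w|e a ha ea IH].
  by rewrite /= (gef_PP hps) eq_sym.
have := path_elt_pcons e g ha; rewrite ea eqxx => <-.
rewrite -amulA IH psource_pcons//; case: eqP => _; last by rewrite amul0r.
by rewrite path_elt_pcons// ea eqxx.
Qed.

Lemma path_elt_split a g : is_path a -> pe a g = pe a 1%g ** p (psource a) g.
Proof. by move=> ha; rewrite path_elt_p// vact1 eqxx mul1g. Qed.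

Lemma p_path_elt0 a g v k : is_path a -> v <> k ·v prange a ->
  p v k ** pe a g = 0.
Proof.
case: a => [w|e [|f es]] ha /= /eqP /negPf nv.
- by rewrite (gef_PP hps) nv.
- by rewrite (gef_PS hps) grange_act nv.
- by rewrite amulA (gef_PS hps) grange_act nv amul0l.
Qed.

(* The path [b] is the translate of [a] by [k], and [k'] is the value of the
   cocycle extended to paths. *)
Lemma p_path_elt a k : is_path a -> exists b k',
  [/\ is_path b, plength b = plength a, prange b = k ·v prange a,
      psource b = k' ·v psource a
    & forall g, p (k ·v prange a) k ** pe a g = pe b (k' * g)%g].
Proof.
move=> ha; elim/path_ind: a / ha k => [w k|e a ha ea IH k].
  by exists (PathV (k ·v w)), k; split=> // g; rewrite /= (gef_PP hps) eqxx.
(* Once [k] has crossed [e], it is [cocycle k e] that acts on the rest of the path; by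
   [cocycle_vact] it moves vertices as [k] does, so the translated edge and tail still compose. *)
have [b [k' [hb lb rb sb pb]]] := IH (cocycle k e).
have sk : gsource (k ·e e) = cocycle k e ·v prange a.
  by rewrite gsource_act ea cocycle_vact.
exists (pcons (k ·e e) b), k'; split.
- by apply: is_path_pcons; rewrite // sk rb.
- by rewrite !plength_pcons lb.
- by rewrite !prange_pcons grange_act.
- by rewrite !psource_pcons// sk rb.
move=> g; have := path_elt_pcons e g ha; rewrite ea eqxx => <-.
rewrite amulA (gef_PS hps) prange_pcons grange_act eqxx mulg1 s_split -amulA sk.
by rewrite pb path_elt_pcons// sk rb eqxx.
Qed.


(** * Degrees of products and adjoints in the graded parts *)

Local Notation W := (graded_part p s).

Lemma graded_submod n : is_submodule (W n). Proof. exact: lspan_submod. Qed.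

Lemma graded0 n : W n 0. Proof. by case: (graded_submod n). Qed.

Lemma star_p1 v : (p v 1%g)^* = p v 1%g.
Proof. by rewrite (gef_star hps) invg1 vact1. Qed.

(** Spanning elements carry their group element only in the unstarred factor. This takes it out of
    an adjoint, so that the factor on the left can absorb it. *)
Lemma star_path_elt a g : is_path a ->
  (pe a g)^* = p ((g^-1)%g ·v psource a) (g^-1)%g ** (pe a 1%g)^*.
Proof. by move=> ha; rewrite path_elt_split// astarM (gef_star hps). Qed.

(* No condition on sources: when they do not match, the element is 0. *)
Lemma graded_elt a b g : is_path a -> is_path b ->
  W ((plength a)%:Z - (plength b)%:Z) (pe a g ** (pe b 1%g)^*).
Proof.
move=> ha hb; have [ab|ab] := eqVneq (g ·v psource b) (psource a).
  by apply: sub_lspan; exists a, b, g; split.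
rewrite (path_elt_split 1 hb) astarM star_p1 amulA path_elt_p// (negPf ab).
by rewrite amul0l; apply: graded0.
Qed.

Lemma graded_path_elt a g : is_path a -> W (plength a)%:Z (pe a g).
Proof.
(* The length-0 path is chosen so that [g] moves its vertex to the source of [a]; multiplying by its
   projection then changes nothing. *)
move=> ha; have := @graded_elt a (PathV ((g^-1)%g ·v psource a)) g ha isT.
by rewrite /= star_p1 path_elt_p// vactV eqxx mulg1 subr0.
Qed.

Lemma graded_p v g : W 0 (p v g). Proof. exact: (@graded_path_elt (PathV v)). Qed.

Lemma graded_s e g : W 1 (s e g). Proof. exact: (@graded_path_elt (PathE e [::])). Qed.

Lemma graded_ind n (Q : set A) : is_submodule Q ->
  (forall a b g, is_path a -> is_path b -> (plength a)%:Z - (plength b)%:Z = n ->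
     Q (pe a g ** (pe b 1%g)^*)) ->
  W n `<=` Q.
Proof.
by move=> sQ h; apply: lspan_min => // x [a [b [g [ha hb _ ab ->]]]]; apply: h.
Qed.

Lemma submodule_amul (Q : set A) y :
  is_submodule Q -> is_submodule [set x | Q (y ** x)].
Proof.
move=> [Q0 QD]; split=> /= [|c x z Qx Qz]; first by rewrite amul0r.
by rewrite amulDr amulZr; apply: QD.
Qed.

Lemma graded_pM v k n x : W n x -> W n (p v k ** x).
Proof.
move: x; apply: graded_ind; first exact/submodule_amul/graded_submod.
move=> a b g ha hb <- /=; rewrite amulA.
have [->|nv] := pselect (v = k ·v prange a); last first.
  by rewrite p_path_elt0// amul0l; apply: graded0.
have [c [k' [hc lc _ _ ->]]] := p_path_elt k ha.
by rewrite -lc; apply: graded_elt.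
Qed.

Lemma graded_sM e n x : W n x -> W (1 + n) (s e 1%g ** x).
Proof.
move: x; apply: graded_ind; first exact/submodule_amul/graded_submod.
move=> a b g ha hb <- /=; rewrite amulA path_elt_pcons//.
case: eqP => [ea|_]; last by rewrite amul0l; apply: graded0.
rewrite addrA -intS -(plength_pcons e).
by apply: graded_elt => //; apply: is_path_pcons.
Qed.

(** Here an edge is appended at the source end. The degree depends only on the length of the new
    path, so [c] and [k] are left unspecified. *)
Lemma path_elt_s b e g : is_path b -> pe b 1%g ** s e g = 0 \/
  exists c k, [/\ is_path c, plength c = (plength b).+1
    & pe b 1%g ** s e g = pe c k].
Proof.
move=> hb; elim/path_ind: b / hb => [w|f b hb fb IH].
  rewrite /= (gef_PS hps); case: eqP => _; last by left.
  (* These are the edge and group element that [gef_PS] produces for the unit, left unsimplified. *)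
  by right; exists (PathE (1%g ·e e) [::]), (cocycle 1%g e * g)%g.
have := path_elt_pcons f 1%g hb; rewrite fb eqxx => <-; rewrite -amulA.
case: IH => [->|[c [k [hc lc ->]]]]; first by left; rewrite amul0r.
rewrite path_elt_pcons//; case: eqP => fc; last by left.
right; exists (pcons f c), k.
by rewrite !plength_pcons lc; split=> //; apply: is_path_pcons.
Qed.

(** If [a] begins with an edge, that edge cancels against [e] or the product is 0. If [a] is a
    vertex there is nothing to cancel, and [e] is appended to the starred path [b] instead; either
    way the degree drops by 1. *)
Lemma graded_star_sM e n x : W n x -> W (- 1 + n) ((s e 1%g)^* ** x).
Proof.
move: x; apply: graded_ind; first exact/submodule_amul/graded_submod.
move=> a b g ha hb <-; elim/path_ind: a / ha => [v|f a ha fa _] /=.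
  have -> : (s e 1%g)^* ** (p v g ** (pe b 1%g)^*) =
      (pe b 1%g ** ((p v g)^* ** s e 1%g))^* by rewrite !astarM astarK amulA.
  rewrite (gef_star hps) (gef_PS hps).
  case: eqP => _; last by rewrite amul0r astar0; apply: graded0.
  have [->|[c [k [hc lc ->]]]] :=
    path_elt_s ((g^-1)%g ·e e) (cocycle (g^-1)%g e * 1)%g hb.
    by rewrite astar0; apply: graded0.
  rewrite star_path_elt// sub0r -opprD -intS -lc -sub0r.
  exact: (@graded_elt (PathV _)).
have := path_elt_pcons f g ha; rewrite fa eqxx => <-.
rewrite !amulA star_s_s; case: eqP => [->|_]; last by rewrite !amul0l; apply: graded0.
rewrite plength_pcons intS addrA addNKr -amulA.
by apply: graded_pM; apply: graded_elt.
Qed.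

Lemma graded_path_eltM a g n x :
  is_path a -> W n x -> W ((plength a)%:Z + n) (pe a g ** x).
Proof.
move=> ha Wx; elim/path_ind: a / ha => [v|e a ha ea IH].
  by rewrite add0r; apply: graded_pM.
have := path_elt_pcons e g ha; rewrite ea eqxx => <-.
by rewrite plength_pcons intS -addrA -amulA; apply: graded_sM.
Qed.

Lemma graded_star_path_eltM b n x :
  is_path b -> W n x -> W (- (plength b)%:Z + n) ((pe b 1%g)^* ** x).
Proof.
(* Adjoints reverse the order, so the first edge acts on [x] first; the induction hypothesis is then
   applied to a different element in a different degree. *)
move=> hb; elim/path_ind: b / hb n x => [v|e b hb eb IH] n x Wx.
  by rewrite oppr0 add0r /= star_p1; apply: graded_pM.
have := path_elt_pcons e 1%g hb; rewrite eb eqxx => <-.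
rewrite plength_pcons intS opprD [- 1 + _]addrC -addrA astarM -amulA.
by apply: IH; apply: graded_star_sM.
Qed.

(** Only the left factor is expanded into spanning elements. The right one stays arbitrary while
    edges and their adjoints are applied to it one by one, which avoids comparing two paths. *)
Lemma graded_mul m n x y : W m x -> W n y -> W (m + n) (x ** y).
Proof.
move=> + Wy; move: x; apply: graded_ind => /=.
  split=> /= [|c x z Wx Wz]; first by rewrite amul0l; apply: graded0.
  by rewrite amulDl amulZl; case: (graded_submod (m + n)) => _; apply.
move=> a b g ha hb <-; rewrite -amulA -addrA.
by apply: graded_path_eltM => //; apply: graded_star_path_eltM.
Qed.

Lemma graded_star n x : W n x -> W (- n) (x ^*).
Proof.
move: x; apply: graded_ind => /=.
  split=> /= [|c x z Wx Wz]; first by rewrite astar0; apply: graded0.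
  by rewrite astarP; case: (graded_submod (- n)) => _; apply.
move=> a b g ha hb <-; rewrite astarM astarK star_path_elt// amulA path_elt_p//.
case: eqP => _; last by rewrite amul0l; apply: graded0.
by rewrite opprB; apply: graded_elt.
Qed.

(** * The (G,E)-family in the external direct sum, and homomorphisms into it *)

Definition graded_filtered : star_filtered A int :=
  StarFiltered graded_submod graded_mul graded_star.

Local Notation D := (dsum graded_filtered).

Definition lift_p v g : D := @dmono _ _ _ graded_filtered _ _ (graded_p v g).
Definition lift_s e g : D := @dmono _ _ _ graded_filtered _ _ (graded_s e g).

Lemma homogeneous_lift_p v g : homogeneous 0 (lift_p v g).
Proof. exact: dmono_homogeneous. Qed.

Lemma homogeneous_lift_s e g : homogeneous 1 (lift_s e g).
Proof. exact: dmono_homogeneous. Qed.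

Lemma deval_lift_p v g : deval (lift_p v g) = p v g.
Proof. exact: deval_mono. Qed.

Lemma deval_lift_s e g : deval (lift_s e g) = s e g.
Proof. exact: deval_mono. Qed.

(** In every relation both sides are homogeneous of the same degree, 0 being homogeneous of every
    degree. By [homogeneous_inj] each relation follows from its counterpart in [A]. *)
Lemma lift_family : is_GE_family lift_p lift_s.
Proof.
have hp := homogeneous_lift_p; have hs := homogeneous_lift_s.
have ep := deval_lift_p; have es := deval_lift_s.
have hE := deval_hom graded_filtered; case: (hE) => _ eM eS.
have e0 := star_hom0 hE.
have hps0 v g : homogeneous 0 ((lift_p v g)^*).
  by rewrite -oppr0; apply: homogeneous_star.
have hss e g : homogeneous (- 1) ((lift_s e g)^*) by apply: homogeneous_star.
have hpp v g w k : homogeneous 0 (lift_p v g ** lift_p w k).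
  by rewrite -[0]addr0; apply: homogeneousM.
have hsss e g f k : homogeneous 0 ((lift_s e g)^* ** lift_s f k).
  by rewrite -[0](addNr 1); apply: homogeneousM.
have hsss' e g f k : homogeneous 0 (lift_s e g ** (lift_s f k)^*).
  by rewrite -[0](addrN 1); apply: homogeneousM.
split; [split|..].
- move=> v; have [h1 h2] := ef_proj (gef_E hps) v.
  split; apply: (homogeneous_inj (n := 0)) => //.
    by rewrite eS !ep.
  by rewrite eM !ep.
- move=> v w vw; apply: (homogeneous_inj (n := 0)) => //.
  by rewrite eM !ep e0; apply: (ef_orth (gef_E hps)).
- move=> e; apply: (homogeneous_inj (n := 1)) => //.
    by rewrite -[1]add0r; apply: homogeneousM.
  by rewrite !eM eS !es; apply: (ef_isom (gef_E hps)).
- move=> e f; apply: (homogeneous_inj (n := 0)) => //; first by case: eqP.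
  rewrite eM eS !es (ef_source (gef_E hps)).
  by case: eqP => _; rewrite ?ep ?e0.
- move=> v; have fv := sst_row_finite v.
  apply: (homogeneous_inj (n := 0)) => //.
    (* Row-finiteness turns the sum over edges into a genuine finite sum. *)
    by rewrite fsbig_finite//; apply: homogeneous_sum.
  rewrite (star_hom_fsum hE)// ep (ef_range (gef_E hps)).
  by apply: eq_fsbigr => e _; rewrite eM eS es.
- move=> v f; apply: (homogeneous_inj (n := 0)) => //.
  by rewrite eS !ep (gef_star hps).
- move=> v w f h; apply: (homogeneous_inj (n := 0)) => //; first by case: eqP.
  by rewrite eM !ep (gef_PP hps); case: eqP => _; rewrite ?ep ?e0.
- move=> v e f g; apply: (homogeneous_inj (n := 1)) => //; last 2 first.
  + by case: eqP.
  + by rewrite eM ep es (gef_PS hps); case: eqP => _; rewrite ?es ?e0.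
  by rewrite -[1]add0r; apply: homogeneousM.
- move=> v e f g; apply: (homogeneous_inj (n := 1)) => //; last 2 first.
  + by case: eqP.
  + by rewrite eM ep es (gef_SP hps); case: eqP => _; rewrite ?es ?e0.
  by rewrite -[1]addr0; apply: homogeneousM.
Qed.

Section Lifted.
Variable h : A -> D.
Hypotheses (hh : star_hom h) (hp : forall v g, h (p v g) = lift_p v g)
  (hs : forall e g, h (s e g) = lift_s e g).

Lemma homogeneous_path_elt a g :
  is_path a -> homogeneous (plength a)%:Z (h (pe a g)).
Proof.
move=> ha; elim/path_ind: a / ha => [v|e a ha ea IH].
  by rewrite /= hp; apply: homogeneous_lift_p.
have := path_elt_pcons e g ha; rewrite ea eqxx => <-.
rewrite plength_pcons intS (star_homM hh) hs.
exact: homogeneousM (homogeneous_lift_s _ _) IH.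
Qed.

(** The generators are sent to degrees 0 and 1, products add degrees and adjoints negate them, so
    the image of each spanning element has degree [plength a - plength b]. *)
Lemma homogeneous_graded n : W n `<=` [set x | homogeneous n (h x)].
Proof.
apply: graded_ind => /= [|a b g ha hb <-].
  split=> /= [|c x y hx hy]; first by rewrite (star_hom0 hh).
  by rewrite (star_homP hh); apply: homogeneousP.
rewrite (star_homM hh) (star_homS hh).
by apply: homogeneousM; [|apply: homogeneous_star]; apply: homogeneous_path_elt.
Qed.

End Lifted.

End Family.

Theorem lemma2p5 (T : self_similar_triple) (R : comStarRingType)
    (L : starAlgType R)
    (p : 'V_T -> 'G_T -> L) (s : 'E_T -> 'G_T -> L)
    (hL : is_universal_GE p s) :
  is_Z_grading (graded_part p s).
Proof.
have [hps univ] := hL.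
have [h [[hh hp hs] _]] := univ _ _ _ (lift_family hps).
have evK x : deval (h x) = x.
  (* Both [deval \o h] and the identity are star-homomorphisms fixing the generators, hence both
     equal [k]. *)
  have [k [_ uk]] := univ _ _ _ hps.
  rewrite -[LHS]/((@deval _ _ _ _ \o h) x) -(uk (@deval _ _ _ _ \o h)).
    by rewrite (uk (fun x => x)).
  split=> [|v g|e g] /=.
  - exact: star_hom_comp hh (deval_hom _).
  - by rewrite hp deval_lift_p.
  - by rewrite hs deval_lift_s.
split; [exact: graded_submod | | exact: graded_mul].
move=> x; exists (h x); split.
  by split; [exact: (dcoef_part (h x)) | exact: (dcoef_fin (h x)) | rewrite -[LHS]evK].
move=> f [Wf ff ->]; apply/funext => n.
have f0 i : i \notin fset_set [set n | f n <> 0%R] -> f i = 0%R.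
  by rewrite in_fset_set// notin_setE; exact: contrapT.
(* The element [h (f i)] lives in degree [i] only, and its coefficient there is its evaluation,
   which is [f i]. Summing over [i] therefore recovers [f n] as the coefficient of [h x] at [n]. *)
have hf i : (h (f i)) n = if n == i then f i else 0%R.
  have hi := homogeneous_graded hh hp hs (Wf i).
  case: eqP => [->|/eqP ni]; last exact: hi.
  by rewrite -(deval_homogeneous hi) evK.
rewrite (fsbigTE _ _ f0) (star_hom_sum hh) dcoef_sum.
under eq_bigr do rewrite hf.
have [nS|/[dup] nS /f0 ->] := boolP (n \in fset_set [set n | f n <> 0%R]).
  rewrite (bigD1_seq n) ?fset_uniq//= eqxx big1 ?addr0// => i.
  by rewrite eq_sym => /negPf ->.
by rewrite big_seq big1// => i iS; case: eqP => // ni; rewrite ni iS in nS.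
Qed.
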